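(* Let $p$ be a prime and let $S$ be an $F$-finite animated commutative $\mathbf{F}_p$-algebra. Then there exist a free $\mathbf{F}_p$-algebra of finite type $R'$ and a relatively perfect $R'$-algebra $T$, along with a map $T\to S$ of animated $\mathbf{F}_p$-algebras that is surjective on $H^0$.
   Context: Animated commutative $\mathbf{F}_p$-algebras (simplicial commutative $\mathbf{F}_p$-algebras up to weak equivalence) are indexed cohomologically: $H^k(R)=\pi_{-k}(R)$. Each such $R$ has a functorial Frobenius endomorphism $F=F_R$. For a map $R\to S$, let $S\otimes^L_{R,F}R$ be the pushout of $S\leftarrow R\xrightarrow{F}R$. The relative Frobenius map $F_{S/R}\colon S\otimes^L_{R,F}R\to S$ is induced by $F_S$ on the first factor and the structure map $R\to S$ on the second. The $R$-algebra $S$ is relatively perfect if $F_{S/R}$ is an equivalence. $S$ is $F$-finite if the Frobenius of the ordinary ring $H^0(S)$ is a finite ring map. A free $\mathbf{F}_p$-algebra of finite type is a polynomial ring $\mathbf{F}_p[x_1,\dots,x_n]$, $n\ge 0$. *)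

(* Defs.v *)
From HB Require Import structures.
From mathcomp Require Import all_boot all_order all_algebra.
From mathcomp Require Import finmap boolp mpoly.

Set Implicit Arguments.
Unset Strict Implicit.
Unset Printing Implicit Defensive.

Import Order.TTheory GRing.Theory.
Local Open Scope ring_scope.
Local Open Scope quotient_scope.

(* An animated commutative F_p-algebra is represented by a simplicial
   commutative F_p-algebra, i.e. a functor from the opposite of the simplex
   category to commutative rings (possibly zero) in which p = 0; an F_p-algebra
   structure is unique when it exists and is preserved by every ring map.
   [n] is the ordered type 'I_n.+1. Functoriality is stated up to pointwise
   equality, since {omorphism _ -> _} bundles functions with proofs. *)
Record sAlg (p : nat) := SAlg {
  sob :> nat -> comPzRingType;
  sact : forall m n, {omorphism 'I_m.+1 -> 'I_n.+1} ->
           {rmorphism sob n -> sob m};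
  sact_id : forall n (f : {omorphism 'I_n.+1 -> 'I_n.+1}),
    f =1 id -> sact f =1 id;
  sact_comp : forall l m n (f : {omorphism 'I_l.+1 -> 'I_m.+1})
      (g : {omorphism 'I_m.+1 -> 'I_n.+1}) (h : {omorphism 'I_l.+1 -> 'I_n.+1}),
    h =1 g \o f -> sact h =1 sact f \o sact g;
  sob_char : forall n, p%:R = 0 :> sob n }.

Record sHom p (X Y : sAlg p) := SHom {
  shom :> forall n, {rmorphism X n -> Y n};
  shom_nat : forall m n (f : {omorphism 'I_m.+1 -> 'I_n.+1}) (x : X n),
    shom m (sact X f x) = sact Y f (shom n x) }.

Section Faces.

Lemma coface_subproof n (i : 'I_n.+2) :
  {homo lift i : j k / (j <= k :> 'I_n.+1)%O >-> (j <= k :> 'I_n.+2)%O}.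
Proof. by move=> j k; rewrite !leEord /= leq_bump2. Qed.

Definition coface n (i : 'I_n.+2) : {omorphism 'I_n.+1 -> 'I_n.+2} :=
  HB.pack (lift i) (Order.isOrderMorphism.Build _ _ _ _ (lift i)
                      (@coface_subproof n i)).

Lemma to_point_subproof n :
  {homo (fun=> ord0) : j k / (j <= k :> 'I_n.+1)%O >-> (j <= k :> 'I_1)%O}.
Proof. by []. Qed.

Definition to_point n : {omorphism 'I_n.+1 -> 'I_1} :=
  HB.pack (fun=> ord0) (Order.isOrderMorphism.Build _ _ _ _ (fun=> ord0)
                      (@to_point_subproof n)).

End Faces.

Definition face p (X : sAlg p) n (i : 'I_n.+2) : {rmorphism X n.+1 -> X n} :=
  sact X (coface i).

(* Homotopy groups as homology of the Moore (normalised) chain complex: the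
   n-cycles are the n-simplices all of whose faces vanish, and the boundaries
   are the elements d_0 w with d_i w = 0 for every i > 0. *)
Section HomotopyGroups.
Variables (p : nat) (X : sAlg p).

Definition is_cycle n : X n -> Prop :=
  match n with
  | 0 => fun=> True
  | k.+1 => fun x => forall i, face X i x = 0
  end.

Definition cycle_pred n : {pred X n} := fun x => `[< is_cycle x >].

Lemma cycle_zmod_closed n : zmod_closed (@cycle_pred n).
Proof.
split; first by apply/asboolP; case: n => //= n i; rewrite rmorph0.
move=> x y /asboolP xc /asboolP yc; apply/asboolP.
case: n x y xc yc => //= n x y xc yc i.
by rewrite rmorphB xc yc subrr.
Qed.

HB.instance Definition _ n :=
  GRing.isZmodClosed.Build (X n) (@cycle_pred n) (@cycle_zmod_closed n).

Record mcycle n := MCycle { mcycle_val :> X n; _ : mcycle_val \in @cycle_pred n }.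

HB.instance Definition _ n := [isSub for @mcycle_val n].
HB.instance Definition _ n := [Choice of mcycle n by <:].
HB.instance Definition _ n := [SubChoice_isSubZmodule of mcycle n by <:].

Definition is_boundary n (x : X n) : Prop :=
  exists w : X n.+1,
    (forall i : 'I_n.+2, i != ord0 -> face X i w = 0) /\ face X ord0 w = x.

Definition boundary_pred n : {pred mcycle n} :=
  fun z => `[< is_boundary (mcycle_val z) >].

Lemma boundary_zmod_closed n : zmod_closed (@boundary_pred n).
Proof.
split.
  by apply/asboolP; exists 0; split=> [i _|]; rewrite rmorph0.
move=> x y /asboolP[v [v0 vx]] /asboolP[w [w0 wy]]; apply/asboolP.
exists (v - w); split=> [i i0|]; first by rewrite rmorphB v0 // w0 // subrr.
by rewrite rmorphB vx wy.
Qed.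

HB.instance Definition _ n :=
  GRing.isZmodClosed.Build (mcycle n) (@boundary_pred n)
    (@boundary_zmod_closed n).

Definition hgroup n : zmodType := Quotient.quot (@boundary_pred n).

Lemma hgroupP n (x y : mcycle n) :
  reflect (is_boundary (mcycle_val x - mcycle_val y))
          (\pi_(hgroup n) x == \pi_(hgroup n) y).
Proof.
by rewrite -Quotient.idealrBE; apply: asboolP.
Qed.

End HomotopyGroups.

Section InducedMap.
Variables (p : nat) (X Y : sAlg p) (f : sHom X Y) (n : nat).

Lemma shom_cycle (z : mcycle X n) :
  f n (mcycle_val z) \in @cycle_pred p Y n.
Proof.
case: z => x /= /asboolP xc; apply/asboolP.
case: n x xc => //= k x xc i.
by rewrite -shom_nat -/(face X i) xc rmorph0.
Qed.

Definition cycle_map (z : mcycle X n) : mcycle Y n := MCycle (shom_cycle z).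

Definition hgroup_map (a : hgroup X n) : hgroup Y n :=
  \pi_(hgroup Y n) (cycle_map (repr a)).

Lemma hgroup_mapE (z : mcycle X n) :
  hgroup_map (\pi_(hgroup X n) z) = \pi_(hgroup Y n) (cycle_map z).
Proof.
apply/eqP/hgroupP => /=.
have /eqP/hgroupP[w [w0 wz]] :
  \pi_(hgroup X n) (repr (\pi_(hgroup X n) z)) = \pi_(hgroup X n) z.
  by rewrite reprK.
exists (f n.+1 w); split=> [i i0|].
  by rewrite -shom_nat -/(face X i) w0 // rmorph0.
by rewrite -shom_nat -/(face X ord0) wz rmorphB.
Qed.

End InducedMap.

Definition weak_equivalence p (X Y : sAlg p) (f : sHom X Y) : Prop :=
  forall n, bijective (hgroup_map f (n := n)).

Section Frobenius.
Variables (p : nat) (p_pr : prime p).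

(* The library's pFrobenius_aut excludes the zero ring. *)
Definition frob (A : comPzRingType) of p%:R = 0 :> A := fun x : A => x ^+ p.

Variables (A : comPzRingType) (charA : p%:R = 0 :> A).

Lemma frob_nmod_morphism : nmod_morphism (frob charA).
Proof.
have p_gt0 := prime_gt0 p_pr.
rewrite /frob; split=> [|x y]; first by rewrite expr0n -[p]prednK.
rewrite exprDn -(prednK p_gt0) big_ord_recl big_ord_recr /= /bump /= !add1n.
rewrite prednK // subn0 subnn !expr0 bin0 binn !mulr1n mulr1 mul1r.
rewrite big1 ?add0r // => i _.
have ip : (0 < i.+1 < p)%N by rewrite /= -[X in (_ < X)%N](prednK p_gt0) ltnS.
have /dvdnP[q ->] := prime_dvd_bin p_pr ip.
by rewrite -mulr_natr natrM charA !mulr0.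
Qed.

Lemma frob_monoid_morphism : monoid_morphism (frob charA).
Proof. by rewrite /frob; split=> [|x y]; rewrite ?expr1n ?exprMn. Qed.

HB.instance Definition _ :=
  GRing.isNmodMorphism.Build A A (frob charA) frob_nmod_morphism.
HB.instance Definition _ :=
  GRing.isMonoidMorphism.Build A A (frob charA) frob_monoid_morphism.

Definition frobenius : {rmorphism A -> A} := frob charA.

End Frobenius.

Section SimplicialFrobenius.
Variables (p : nat) (p_pr : prime p) (X : sAlg p).

Lemma sFrobenius_nat m n (f : {omorphism 'I_m.+1 -> 'I_n.+1}) (x : X n) :
  frobenius p_pr (sob_char X m) (sact X f x)
    = sact X f (frobenius p_pr (sob_char X n) x).
Proof. by rewrite /= /frob rmorphXn. Qed.

Definition sFrobenius : sHom X X := SHom sFrobenius_nat.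

End SimplicialFrobenius.

(* H^0 as a ring: every 0-simplex is a 0-cycle, and multiplication is that of
   0-simplices. *)
Section H0.
Variables (p : nat) (X : sAlg p).

Definition H0 : Type := hgroup X 0.
HB.instance Definition _ := GRing.Zmodule.on H0.

Lemma vertex_subproof (x : X 0) : x \in @cycle_pred p X 0.
Proof. exact/asboolP. Qed.

Definition H0_class (x : X 0) : H0 :=
  \pi_(hgroup X 0) (MCycle (vertex_subproof x)).
Definition H0_repr (a : H0) : X 0 := mcycle_val (repr (a : hgroup X 0)).

Lemma H0_reprK : cancel H0_repr H0_class.
Proof.
move=> a; rewrite /H0_class /H0_repr -[RHS]reprK; congr (\pi _).
exact: val_inj.
Qed.

Lemma H0_classP (x y : X 0) :
  reflect (is_boundary (x - y)) (H0_class x == H0_class y).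
Proof.
exact: (@hgroupP p X 0 (MCycle (vertex_subproof x)) (MCycle (vertex_subproof y))).
Qed.

Lemma H0_classD : {morph H0_class : x y / x + y}.
Proof.
move=> x y; rewrite /H0_class; set z := MCycle _.
have -> : z = MCycle (vertex_subproof x) + MCycle (vertex_subproof y).
  exact: val_inj.
exact: Quotient.pi_add.
Qed.

Definition H0_one : H0 := H0_class 1.
Definition H0_mul (a b : H0) : H0 := H0_class (H0_repr a * H0_repr b).

Lemma boundaryMl (a x : X 0) : is_boundary x -> is_boundary (a * x).
Proof.
have cst i : face X i (sact X (to_point 1) a) = a.
  have comp0 : to_point 0 =1 to_point 1 \o coface i by [].
  rewrite -[LHS](sact_comp comp0 a) sact_id // => j.
  by rewrite (ord1 j).
case=> w [w0 <-]; exists (sact X (to_point 1) a * w).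
split=> [i i0|]; last by rewrite rmorphM; congr (_ * _); exact: cst.
by rewrite rmorphM w0 // mulr0.
Qed.

Lemma boundaryD (x y : X 0) :
  is_boundary x -> is_boundary y -> is_boundary (x + y).
Proof.
case=> v [v0 <-] [w [w0 <-]]; exists (v + w).
by split=> [i i0|]; rewrite rmorphD // v0 // w0 // addr0.
Qed.

Lemma H0_classM (x y : X 0) : H0_class (x * y) = H0_mul (H0_class x) (H0_class y).
Proof.
apply/eqP; rewrite eq_sym; apply/H0_classP.
set u := H0_repr _; set v := H0_repr _.
have ux : is_boundary (u - x) by apply/H0_classP; rewrite H0_reprK.
have vy : is_boundary (v - y) by apply/H0_classP; rewrite H0_reprK.
have -> : u * v - x * y = v * (u - x) + x * (v - y).
  by rewrite !mulrBr [v * u]mulrC [v * x]mulrC addrA subrK.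
by apply: boundaryD; apply: boundaryMl.
Qed.

Lemma H0_mulA : associative H0_mul.
Proof.
move=> a b c; rewrite -(H0_reprK a) -(H0_reprK b) -(H0_reprK c).
by rewrite -!H0_classM mulrA.
Qed.

Lemma H0_mulC : commutative H0_mul.
Proof. by move=> a b; rewrite /H0_mul mulrC. Qed.

Lemma H0_mul1 : left_id H0_one H0_mul.
Proof. by move=> a; rewrite -(H0_reprK a) -H0_classM mul1r. Qed.

Lemma H0_mulD : left_distributive H0_mul +%R.
Proof.
move=> a b c; rewrite -(H0_reprK a) -(H0_reprK b) -(H0_reprK c).
by rewrite -H0_classD -!H0_classM mulrDl H0_classD.
Qed.

HB.instance Definition _ :=
  GRing.Zmodule_isComPzRing.Build H0 H0_mulA H0_mulC H0_mul1 H0_mulD.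

Lemma H0_char : p%:R = 0 :> H0.
Proof.
have nat n : H0_class n%:R = n%:R.
  elim: n => [|n IH]; last by rewrite !mulrS H0_classD IH.
  by apply: (addIr (H0_class 0)); rewrite -H0_classD !add0r.
by rewrite -nat sob_char; exact: (nat 0%N).
Qed.

End H0.

Definition H0_map p (X Y : sAlg p) (f : sHom X Y) : H0 X -> H0 Y :=
  hgroup_map f (n := 0).

Definition finite_ring_map (A B : comPzRingType) (f : {rmorphism A -> B}) : Prop :=
  exists (n : nat) (g : 'I_n -> B),
    forall b, exists a : 'I_n -> A, b = \sum_(i < n) f (a i) * g i.

Definition F_finite p (p_pr : prime p) (S : sAlg p) : Prop :=
  finite_ring_map (frobenius p_pr (H0_char S)).

Definition free_ring_map (A B : comPzRingType) (f : {rmorphism A -> B}) : Prop :=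
  exists (I : choiceType) (e : I -> B),
    forall b, exists! c : {fsfun I -> A with 0},
      b = \sum_(i <- finsupp c) f (c i) * e i.

Definition is_pushout p (R S Q P : sAlg p) (f : sHom R S) (j : sHom R Q)
    (u : sHom S P) (v : sHom Q P) : Prop :=
  (forall n, u n \o f n =1 v n \o j n) /\
  forall (W : sAlg p) (a : sHom S W) (b : sHom Q W),
    (forall n, a n \o f n =1 b n \o j n) ->
    exists h : sHom P W,
      [/\ forall n, h n \o u n =1 a n,
          forall n, h n \o v n =1 b n
        & forall k : sHom P W,
            (forall n, k n \o u n =1 a n) -> (forall n, k n \o v n =1 b n) ->
            forall n, k n =1 h n].

(* A model of the pushout of S <-f- R -g-> R' in animated algebras, i.e. of the
   derived tensor product of S and R' over R: the strict pushout
   dp_obj = S (x)_R dp_res, where dp_res -> R' is a resolution of R' by a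
   simplicial R-algebra whose terms are free modules over the terms of R.
   Such resolutions exist (e.g. polynomial ones), and the result does not
   depend on the choice up to weak equivalence. *)
Record derived_pushout p (R S R' : sAlg p) (f : sHom R S) (g : sHom R R') :=
  DerivedPushout {
    dp_res : sAlg p;
    dp_incl : sHom R dp_res;
    dp_aug : sHom dp_res R';
    dp_fact : forall n, dp_aug n \o dp_incl n =1 g n;
    dp_free : forall n, free_ring_map (dp_incl n);
    dp_weq : weak_equivalence dp_aug;
    dp_obj : sAlg p;
    dp_inl : sHom S dp_obj;
    dp_inr : sHom dp_res dp_obj;
    dp_pushout : is_pushout f dp_incl dp_inl dp_inr }.

Definition is_relative_frobenius p (p_pr : prime p) (R S : sAlg p)
    (f : sHom R S) (D : derived_pushout f (sFrobenius p_pr R))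
    (h : sHom (dp_obj D) S) : Prop :=
  (forall n, h n \o dp_inl D n =1 sFrobenius p_pr S n) /\
  (forall n, h n \o dp_inr D n =1 f n \o dp_aug D n).

Definition relatively_perfect p (p_pr : prime p) (R S : sAlg p)
    (f : sHom R S) : Prop :=
  exists (D : derived_pushout f (sFrobenius p_pr R)) (h : sHom (dp_obj D) S),
    is_relative_frobenius h /\ weak_equivalence h.

(* A map X -> Y of animated algebras: a strict map to Y from a simplicial
   algebra weakly equivalent to X. Every map in the localisation at weak
   equivalences has this form, as all simplicial algebras are fibrant. *)
Record aMap p (X Y : sAlg p) := AMap {
  am_src : sAlg p;
  am_weq : sHom am_src X;
  am_weqP : weak_equivalence am_weq;
  am_map : sHom am_src Y }.

(* Surjectivity of H^0(X) -> H^0(Y); H^0(am_src) -> H^0(X) is bijective. *)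
Definition H0_surjective p (X Y : sAlg p) (phi : aMap X Y) : Prop :=
  forall y : H0 Y, exists a : H0 (am_src phi), H0_map (am_map phi) a = y.

Section FreeAlgebra.
Variables (p : nat) (p_pr : prime p) (k : nat).

Lemma mpoly_char : p%:R = 0 :> {mpoly 'F_p[k]}.
Proof.
rewrite -(rmorph_nat (@mpolyC k 'F_p)).
by have /andP[_ /eqP ->] := pchar_Fp p_pr; rewrite rmorph0.
Qed.

(* The discrete simplicial algebra F_p[x_1, ..., x_k]. *)
Definition free_alg : sAlg p :=
  @SAlg p (fun=> {mpoly 'F_p[k]}) (fun _ _ _ => idfun)
    (fun _ _ _ _ => erefl) (fun _ _ _ _ _ _ _ _ => erefl) (fun=> mpoly_char).

End FreeAlgebra.

(* Main.v *)
From HB Require Import structures.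
Require Import Defs.
From mathcomp Require Import all_boot all_order all_algebra.
From mathcomp Require Import finmap boolp mpoly zify.

(* Let g_1, ..., g_k generate H^0(S) as a module over its Frobenius and write
   R' = F_p[x_1, ..., x_k]. Take T = R'[s_l]/(s_l = \sum_i s_(l i)^p x_i), where
   l runs over the nodes of a forest of k-ary trees whose roots are the
   0-simplices of S. The relation makes T a strict pushout of itself along the
   Frobenius of R', with inverse s_l |-> \sum_i s_(l i) x_i, so T is relatively
   perfect over R' (whose Frobenius is free).

   Every element of H^0(S) has the form \sum_i a_i^p g_i, so every vertex of S is
   joined by a path to some \sum_i v_i^p x_i, where x_i lifts g_i. Replacing the relations of T
   by freely adjoined paths gives a simplicial algebra Q which therefore maps to
   S, hitting every vertex. The augmentation Q -> T is a weak equivalence: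
   contracting the paths at the roots deforms Q onto the algebra of the
   forest with the roots removed, and after finitely many such steps any given
   cycle becomes a degenerate simplex. *)

Set Implicit Arguments.
Unset Strict Implicit.
Unset Printing Implicit Defensive.

Import Order.TTheory GRing.Theory.
Local Open Scope ring_scope.
Local Open Scope quotient_scope.

(** * Rings given by generators and relations *)

Inductive term (G : Type) : Type :=
| TGen of G
| TZero
| TOne
| TAdd of term G & term G
| TOpp of term G
| TMul of term G & term G.
Arguments TZero {G}.
Arguments TOne {G}.

(** Equality and choice are classical here, the type of generators being arbitrary. *)
HB.instance Definition _ (G : Type) := gen_eqMixin (term G).
HB.instance Definition _ (G : Type) := gen_choiceMixin (term G).

Fixpoint teval (G : Type) (B : comPzRingType) (v : G -> B) (t : term G) : B :=
  match t with
  | TGen g => v g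
  | TZero => 0
  | TOne => 1
  | TAdd t u => teval v t + teval v u
  | TOpp t => - teval v t
  | TMul t u => teval v t * teval v u
  end.

Section Presented.
Variables (p : nat) (G I : Type) (lhs rhs : I -> term G).

Definition solution (B : comPzRingType) (v : G -> B) : Prop :=
  p%:R = 0 :> B /\ forall i, teval v (lhs i) = teval v (rhs i).

(* Quantifying over all solutions makes the universal property of the quotient
   immediate, with no need to generate a congruence. *)
Definition term_eq (t u : term G) : bool :=
  `[< forall (B : comPzRingType) (v : G -> B),
        solution v -> teval v t = teval v u >].

Lemma term_eq_refl : reflexive term_eq.
Proof. by move=> t; apply/asboolP. Qed.

Lemma term_eq_sym : ssrbool.symmetric term_eq.
Proof.
by move=> t u; apply/asboolP/asboolP=> tu B v sv; rewrite tu.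
Qed.

Lemma term_eq_trans : transitive term_eq.
Proof.
move=> t u w /asboolP ut /asboolP tw; apply/asboolP=> B v sv.
by rewrite ut // tw.
Qed.

Canonical term_equiv := EquivRel term_eq term_eq_refl term_eq_sym term_eq_trans.

Definition presented := {eq_quot term_eq}.
HB.instance Definition _ := Choice.on presented.
HB.instance Definition _ := Quotient.on presented.

Lemma presented_eqP (t u : term G) :
  (forall (B : comPzRingType) (v : G -> B),
     solution v -> teval v t = teval v u) ->
  \pi_presented t = \pi_presented u.
Proof. by move=> tu; apply/eqmodP/asboolP. Qed.

Section Lift.
Variables (B : comPzRingType) (v : G -> B).

(** Having the proof of [solution v] as an argument allows ring morphism structures to be declared
    on [peval sv]. *)
Definition peval of solution v := fun a : presented => teval v (repr a).

Hypothesis sv : solution v.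

Lemma peval_pi (t : term G) : peval sv (\pi t) = teval v t.
Proof.
have /eqmodP/asboolP : \pi_presented (repr (\pi_presented t)) = \pi t.
  by rewrite reprK.
exact.
Qed.

End Lift.


(** Reduces each ring axiom of [presented] to the same axiom in the test rings. *)
Lemma presented_ext (a b : presented) :
  (forall (B : comPzRingType) (v : G -> B) (sv : solution v),
     peval sv a = peval sv b) -> a = b.
Proof.
move=> ab; rewrite -[a]reprK -[b]reprK; apply: presented_eqP => B v sv.
exact: (ab B v sv).
Qed.

Definition padd (a b : presented) := \pi_presented (TAdd (repr a) (repr b)).
Definition pmul (a b : presented) := \pi_presented (TMul (repr a) (repr b)).
Definition popp (a : presented) := \pi_presented (TOpp (repr a)).

Section Eval.
Variables (B : comPzRingType) (v : G -> B) (sv : solution v).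
Lemma peval_add a b : peval sv (padd a b) = peval sv a + peval sv b.
Proof. exact: peval_pi. Qed.
Lemma peval_mul a b : peval sv (pmul a b) = peval sv a * peval sv b.
Proof. exact: peval_pi. Qed.
Lemma peval_opp a : peval sv (popp a) = - peval sv a.
Proof. exact: peval_pi. Qed.
Lemma peval_zero : peval sv (\pi TZero) = 0.
Proof. exact: peval_pi. Qed.
Lemma peval_one : peval sv (\pi TOne) = 1.
Proof. exact: peval_pi. Qed.
End Eval.

Let pevalE :=
  (peval_add, peval_mul, peval_opp, peval_zero, peval_one).

Lemma paddA : associative padd.
Proof. by move=> a b c; apply: presented_ext => B v sv; rewrite !pevalE addrA. Qed.

Lemma paddC : commutative padd.
Proof. by move=> a b; apply: presented_ext => B v sv; rewrite !pevalE addrC. Qed.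

Lemma padd0 : left_id (\pi_presented TZero) padd.
Proof. by move=> a; apply: presented_ext => B v sv; rewrite !pevalE add0r. Qed.

Lemma paddN : left_inverse (\pi_presented TZero) popp padd.
Proof. by move=> a; apply: presented_ext => B v sv; rewrite !pevalE addNr. Qed.

HB.instance Definition _ :=
  GRing.isZmodule.Build presented paddA paddC padd0 paddN.

Lemma pmulA : associative pmul.
Proof. by move=> a b c; apply: presented_ext => B v sv; rewrite !pevalE mulrA. Qed.

Lemma pmulC : commutative pmul.
Proof. by move=> a b; apply: presented_ext => B v sv; rewrite !pevalE mulrC. Qed.

Lemma pmul1 : left_id (\pi_presented TOne) pmul.
Proof. by move=> a; apply: presented_ext => B v sv; rewrite !pevalE mul1r. Qed.

Lemma pmulD : left_distributive pmul (+%R : presented -> presented -> presented).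
Proof.
move=> a b c; apply: presented_ext => B v sv.
by rewrite !(peval_mul, peval_add sv) mulrDl.
Qed.

HB.instance Definition _ :=
  GRing.Zmodule_isComPzRing.Build presented pmulA pmulC pmul1 pmulD.

Definition pgen (g : G) : presented := \pi_presented (TGen g).

Lemma teval_pgen (t : term G) : teval pgen t = \pi_presented t.
Proof.
elim: t => //= [t -> u ->|t ->|t -> u ->]; apply: presented_ext => B v sv.
- by rewrite (peval_add sv) !peval_pi.
- by rewrite (peval_opp sv) !peval_pi.
- by rewrite (peval_mul sv) !peval_pi.
Qed.

Lemma pgen_solution : solution pgen.
Proof.
split=> [|i]; last first.
  by rewrite !teval_pgen; apply: presented_eqP => B v [_ ->].
apply: presented_ext => B v sv.
(* [peval] has no morphism structure yet, so numerals are evaluated by induction. *)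
have natE n : peval sv n%:R = n%:R.
  elim: n => [|n IHn]; first exact: (peval_zero sv).
  by rewrite !mulrS (peval_add sv) IHn (peval_one sv).
by rewrite natE (peval_zero sv) sv.1.
Qed.

Lemma presented_ind (P : presented -> Prop) :
    (forall g, P (pgen g)) -> P 0 -> P 1 ->
    (forall a b, P a -> P b -> P (a + b)) -> (forall a, P a -> P (- a)) ->
    (forall a b, P a -> P b -> P (a * b)) ->
  forall a, P a.
Proof.
move=> Pg P0 P1 PD PN PM a; rewrite -[a]reprK -teval_pgen.
by elim: (repr a) => //= *; auto.
Qed.

Section LiftMorphism.
Variables (B : comPzRingType) (v : G -> B) (sv : solution v).

Lemma peval_nmod_morphism : nmod_morphism (peval sv).
Proof. by split; [exact: peval_zero | exact: peval_add]. Qed.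

Lemma peval_monoid_morphism : monoid_morphism (peval sv).
Proof. by split; [exact: peval_one | exact: peval_mul]. Qed.

HB.instance Definition _ :=
  GRing.isNmodMorphism.Build presented B (peval sv) peval_nmod_morphism.
HB.instance Definition _ :=
  GRing.isMonoidMorphism.Build presented B (peval sv) peval_monoid_morphism.

Definition plift : {rmorphism presented -> B} := peval sv.

Lemma plift_gen g : plift (pgen g) = v g.
Proof. exact: peval_pi. Qed.

End LiftMorphism.

Lemma presented_hom_ext (B : comPzRingType) (f g : {rmorphism presented -> B}) :
  (forall x, f (pgen x) = g (pgen x)) -> f =1 g.
Proof.
move=> fg; apply: presented_ind => //; first by rewrite !rmorph0.
- by rewrite !rmorph1.
- by move=> a b fa fb; rewrite !rmorphD fa fb.
- by move=> a fa; rewrite !rmorphN fa.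
- by move=> a b fa fb; rewrite !rmorphM fa fb.
Qed.

End Presented.

(** * Algebras with relations y = \sum_i y_i^p x_i *)

Section FrobeniusPresentation.
Variables (p k : nat) (K L : Type) (c : L -> K) (e : L -> 'I_k -> K).

(** The generator [inl i] is x_i and [inr a] is y_a. Both the algebra T and every degree of its
    resolution are of this shape. *)
Definition frob_sum (l : L) : term ('I_k + K) :=
  foldr (fun i => TAdd (TMul (iter p (TMul (TGen (inr (e l i)))) TOne)
                             (TGen (inl i))))
        TZero (enum 'I_k).

Lemma teval_frob_sum (B : comPzRingType) (v : 'I_k + K -> B) (l : L) :
  teval v (frob_sum l) = \sum_(i < k) v (inr (e l i)) ^+ p * v (inl i).
Proof.
rewrite -big_enum /= /frob_sum; elim: (enum _) => [|i s IHs] /=.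
  by rewrite big_nil.
rewrite big_cons IHs; congr (_ * _ + _).
by elim: p => //= q ->; rewrite exprS.
Qed.

Definition frob_solution (B : comPzRingType) (x : 'I_k -> B) (y : K -> B) :=
  p%:R = 0 :> B /\ forall l, y (c l) = \sum_(i < k) y (e l i) ^+ p * x i.

Definition frob_lhs (l : L) : term ('I_k + K) := TGen (inr (c l)).

Definition frob_alg : comPzRingType := presented p frob_lhs frob_sum.

Definition fx (i : 'I_k) : frob_alg := pgen p frob_lhs frob_sum (inl i).
Definition fy (a : K) : frob_alg := pgen p frob_lhs frob_sum (inr a).

Lemma frob_alg_solution : frob_solution fx fy.
Proof.
have [p0 rel] := pgen_solution p frob_lhs frob_sum.
by split=> // l; have := rel l; rewrite teval_frob_sum.
Qed.

Lemma frob_alg_char : p%:R = 0 :> frob_alg.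
Proof. exact: frob_alg_solution.1. Qed.

Lemma frob_alg_rel l : fy (c l) = \sum_(i < k) fy (e l i) ^+ p * fx i.
Proof. exact: frob_alg_solution.2. Qed.

Lemma frob_solutionP (B : comPzRingType) (x : 'I_k -> B) (y : K -> B) :
  frob_solution x y ->
  solution p frob_lhs frob_sum
    (fun g => match g with inl i => x i | inr a => y a end).
Proof. by case=> p0 rel; split=> // l; rewrite teval_frob_sum /= rel. Qed.

Section Lift.
Variables (B : comPzRingType) (x : 'I_k -> B) (y : K -> B).
Hypothesis sxy : frob_solution x y.

Definition flift : {rmorphism frob_alg -> B} := plift (frob_solutionP sxy).

Lemma flift_x i : flift (fx i) = x i.
Proof. exact: plift_gen. Qed.

Lemma flift_y a : flift (fy a) = y a.
Proof. exact: plift_gen. Qed.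

End Lift.

Lemma frob_alg_ext (B : comPzRingType) (f g : {rmorphism frob_alg -> B}) :
  (forall i, f (fx i) = g (fx i)) -> (forall a, f (fy a) = g (fy a)) -> f =1 g.
Proof. by move=> fgx fgy; apply: presented_hom_ext => -[]. Qed.

Lemma frob_alg_ind (P : frob_alg -> Prop) :
    (forall i, P (fx i)) -> (forall a, P (fy a)) -> P 0 -> P 1 ->
    (forall a b, P a -> P b -> P (a + b)) -> (forall a, P a -> P (- a)) ->
    (forall a b, P a -> P b -> P (a * b)) ->
  forall a, P a.
Proof. by move=> Px Py *; apply: presented_ind => // -[]. Qed.

End FrobeniusPresentation.
Arguments flift {p k K L c e B x y}.

(** * Simplicial algebras and homotopies *)

Lemma omorphism_eq m n (f g : {omorphism 'I_m.+1 -> 'I_n.+1}) : f =1 g -> f = g.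
Proof.
case: f => f [[fP]]; case: g => g [[gP]] /= /funext fg.
by subst g; rewrite (Prop_irrelevance fP gP).
Qed.

(** * Monotone maps, in particular the simplices of Delta^1 *)

Section Omorphisms.

Lemma cst_om_subproof m n (a : 'I_n.+1) :
  {homo (fun=> a) : j k / (j <= k :> 'I_m.+1)%O >-> (j <= k :> 'I_n.+1)%O}.
Proof. by []. Qed.

Definition cst_om m n (a : 'I_n.+1) : {omorphism 'I_m.+1 -> 'I_n.+1} :=
  HB.pack (fun=> a) (Order.isOrderMorphism.Build _ _ _ _ (fun=> a)
                      (@cst_om_subproof m n a)).

Lemma codegen_subproof0 n (i : 'I_n.+1) (j : 'I_n.+2) : (unbump i j < n.+1)%N.
Proof.
by rewrite /unbump; have := ltn_ord i; have := ltn_ord j; lia.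
Qed.

Definition codegen_fun n (i : 'I_n.+1) (j : 'I_n.+2) : 'I_n.+1 :=
  Ordinal (codegen_subproof0 i j).

Lemma codegen_subproof n (i : 'I_n.+1) :
  {homo codegen_fun i : j k / (j <= k :> 'I_n.+2)%O >-> (j <= k :> 'I_n.+1)%O}.
Proof.
by move=> j k; rewrite !leEord /= /unbump; lia.
Qed.

Definition codegen n (i : 'I_n.+1) : {omorphism 'I_n.+2 -> 'I_n.+1} :=
  HB.pack (codegen_fun i) (Order.isOrderMorphism.Build _ _ _ _ (codegen_fun i)
                      (@codegen_subproof n i)).

Lemma threshold_subproof m (i : nat) :
  {homo (fun j : 'I_m.+1 => inord (i <= j)%N : 'I_2) : j k /
    (j <= k :> 'I_m.+1)%O >-> (j <= k :> 'I_2)%O}.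
Proof.
move=> j k; rewrite !leEord /= !inordK ?ltnS ?leq_b1 //; lia.
Qed.

(** These are the m-simplices of Delta^1, running from the constant 1 at [i = 0] to the constant 0
    at [i = m + 1]. *)
Definition threshold m (i : nat) : {omorphism 'I_m.+1 -> 'I_2} :=
  HB.pack (fun j : 'I_m.+1 => inord (i <= j)%N : 'I_2)
    (Order.isOrderMorphism.Build _ _ _ _
       (fun j : 'I_m.+1 => inord (i <= j)%N : 'I_2) (@threshold_subproof m i)).

Lemma max_om_subproof m (f g : {omorphism 'I_m.+1 -> 'I_2}) :
  {homo (fun j => Order.max (f j) (g j)) : j k /
    (j <= k :> 'I_m.+1)%O >-> (j <= k :> 'I_2)%O}.
Proof.
by move=> j k jk; rewrite ge_max !le_max !omorph_le ?orbT.
Qed.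

(** The map Delta^1 x Delta^1 -> Delta^1 that contracts the interval onto its vertex 1. *)
Definition max_om m (f g : {omorphism 'I_m.+1 -> 'I_2}) :
    {omorphism 'I_m.+1 -> 'I_2} :=
  HB.pack (fun j => Order.max (f j) (g j))
    (Order.isOrderMorphism.Build _ _ _ _
       (fun j => Order.max (f j) (g j)) (@max_om_subproof m f g)).

Lemma max_omE m (f g : {omorphism 'I_m.+1 -> 'I_2}) j :
  max_om f g j = maxn (f j) (g j) :> nat.
Proof. by rewrite /= /Order.max ltEord; case: ltngtP => // ->. Qed.

Lemma max_om_maxl m (f : {omorphism 'I_m.+1 -> 'I_2}) :
  max_om (cst_om m ord_max) f = cst_om m ord_max.
Proof.
apply: omorphism_eq => i; apply: ord_inj.
by rewrite max_omE /=; apply/maxn_idPl; rewrite -ltnS ltn_ord.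
Qed.

Lemma max_om_maxr m (f : {omorphism 'I_m.+1 -> 'I_2}) :
  max_om f (cst_om m ord_max) = cst_om m ord_max.
Proof.
apply: omorphism_eq => i; apply: ord_inj.
by rewrite max_omE /=; apply/maxn_idPr; rewrite -ltnS ltn_ord.
Qed.

Lemma max_om_min m (f : {omorphism 'I_m.+1 -> 'I_2}) :
  max_om f (cst_om m ord0) = f.
Proof. by apply: omorphism_eq => i; apply: ord_inj; rewrite max_omE maxn0. Qed.

End Omorphisms.

(** * Faces, degeneracies and boundaries *)

Section SimplicialAlgebra.
Variables (p : nat) (X : sAlg p).

Lemma sact_ext m n (f g : {omorphism 'I_m.+1 -> 'I_n.+1}) :
  f =1 g -> sact X f =1 sact X g.
Proof. by move=> /omorphism_eq ->. Qed.

Lemma sactA l m n (f : {omorphism 'I_l.+1 -> 'I_m.+1})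
    (g : {omorphism 'I_m.+1 -> 'I_n.+1}) (x : X n) :
  sact X f (sact X g x) = sact X (g \o f) x.
Proof. by rewrite (@sact_comp _ X _ _ _ f g (g \o f)). Qed.

(** A monotone map that misses [i] factors through the i-th coface. *)
Lemma sact_missing m n (w : X n.+1) (i : 'I_n.+2)
    (g : {omorphism 'I_m.+1 -> 'I_n.+2}) :
  face X i w = 0 -> (forall j, g j != i) -> sact X g w = 0.
Proof.
move=> wi gi.
pose g0 j : 'I_n.+1 := odflt ord0 (unlift i (g j)).
have g0K j : lift i (g0 j) = g j.
  rewrite /g0; have := gi j; rewrite eq_sym.
  by move=> /unlift_some [k -> ->].
have g0_le : {homo g0 : j k / (j <= k :> 'I_m.+1)%O >-> (j <= k :> 'I_n.+1)%O}.
  move=> j k /(omorph_le g); rewrite -!g0K !leEord /= leq_bump2 //.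
pose g' : {omorphism 'I_m.+1 -> 'I_n.+1} :=
  HB.pack g0 (Order.isOrderMorphism.Build _ _ _ _ g0 g0_le).
rewrite (@sact_ext _ _ g (coface i \o g')) => [|j]; last by rewrite /= g0K.
by rewrite -sactA -/(face X i) wi rmorph0.
Qed.

Lemma face_codegen_id n (i : 'I_n.+1) (j : 'I_n.+2) (z : X n) :
  (j == i :> nat) || (j == i.+1 :> nat) -> face X j (sact X (codegen i) z) = z.
Proof.
move=> ji; rewrite /face sactA sact_id // => l; apply: val_inj => /=.
by rewrite /unbump /bump; lia.
Qed.

Lemma face_codegen_cycle n (i : 'I_n.+2) (j : 'I_n.+3) (z : X n.+1) :
  is_cycle z -> j != i :> nat -> j != i.+1 :> nat ->
  face X j (sact X (codegen i) z) = 0.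
Proof.
move=> zc ji ji1; rewrite /face sactA.
(* Outside i and i + 1, the index [j] is the only preimage of [codegen i j], so the composite misses
   that vertex. *)
apply: (@sact_missing _ _ _ (codegen i j)) => // l.
by rewrite -val_eqE /= /unbump /bump; lia.
Qed.

Lemma is_boundaryD n (x y : X n) :
  is_boundary x -> is_boundary y -> is_boundary (x + y).
Proof.
case=> v [v0 <-] [w [w0 <-]]; exists (v + w).
by split=> [i i0|]; rewrite rmorphD // v0 // w0 // addr0.
Qed.

Lemma is_boundaryN n (x : X n) : is_boundary x -> is_boundary (- x).
Proof.
case=> w [w0 <-]; exists (- w).
by split=> [i i0|]; rewrite rmorphN // w0 // oppr0.
Qed.

(* Subtracting a degeneracy of the i-th face moves that face, up to sign, to
   position i - 1. *)
Lemma face_boundary n (w : X n.+2) (i : 'I_n.+3) :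
  (forall j, j != i -> face X j w = 0) -> is_boundary (face X i w).
Proof.
case: i => i; elim: i w => [|i IHi] w lti wi.
  exists w; split=> [j j0|]; first by apply: wi; rewrite -val_eqE.
  by congr (face X _ w); apply: val_inj.
set u := face X _ w.
(* A face of [u] omits a second vertex of [w], hence is also a face of some other face of [w], which
   vanishes. *)
have uc : is_cycle u.
  move=> j; rewrite /u /face sactA.
  set i0 := Ordinal lti.
  have := neq_lift i0 j; rewrite eq_sym => /wi w0.
  apply: (sact_missing w0) => l.
  by rewrite /= (inj_eq lift_inj) eq_sym neq_lift.
have lti2 : (i < n.+2)%N by [].
have lti3 : (i < n.+3)%N by exact: (ltnW lti).
pose w' := w - sact X (codegen (Ordinal lti2)) u.
have w'E : face X (Ordinal lti3) w' = - u.
  by rewrite rmorphB face_codegen_id ?eqxx // wi ?sub0r // -val_eqE /= ltn_eqF.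
rewrite -[u]opprK -w'E; apply/is_boundaryN/IHi => j; rewrite -val_eqE /= => ji.
rewrite rmorphB; have [ji1|ji1] := eqVneq (j : nat) i.+1.
  rewrite face_codegen_id /= ?ji1 ?eqxx ?orbT //.
  have -> : j = Ordinal lti by apply: val_inj.
  exact: subrr.
by rewrite (face_codegen_cycle uc) // wi ?subr0 // -val_eqE.
Qed.

End SimplicialAlgebra.

Lemma shom_boundary p (X Y : sAlg p) (f : sHom X Y) n (x : X n) :
  is_boundary x -> is_boundary (f n x).
Proof.
case=> w [w0 <-]; exists (f n.+1 w); split=> [i i0|].
  by rewrite -shom_nat -/(face X i) w0 // rmorph0.
by rewrite -shom_nat.
Qed.

(** * Simplicial homotopies *)

Section Homotopy.
Variables (p : nat) (X Y : sAlg p).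
(** [H a x] is the value at the simplex (x, a) of a map from X x Delta^1 to Y. *)
Variable H : forall m, {omorphism 'I_m.+1 -> 'I_2} -> {rmorphism X m -> Y m}.
Hypothesis H_nat : forall m n (f : {omorphism 'I_m.+1 -> 'I_n.+1})
  (a : {omorphism 'I_n.+1 -> 'I_2}) (x : X n),
  sact Y f (H a x) = H (a \o f) (sact X f x).

(** The i-th top simplex of the prism over [z] has the two values as its faces i and i + 1, and its
    other faces vanish because [z] is a cycle. Subtracting a degeneracy of [u] kills face i + 1 and
    leaves the difference on face i. *)
Lemma homotopy_step n (z : X n.+1) (i : 'I_n.+2) :
  is_cycle z ->
  is_boundary (H (threshold n.+1 i) z - H (threshold n.+1 i.+1) z).
Proof.
move=> zc.
pose s := codegen i.
pose u := H (threshold n.+1 i.+1) z.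
pose w := H (threshold n.+2 i.+1) (sact X s z) - sact Y s u.
have uc : is_cycle u by move=> j; rewrite /u /face H_nat zc rmorph0.
have i3 : (i < n.+3)%N by apply: leqW.
have wE : face Y (Ordinal i3) w = H (threshold n.+1 i) z - u.
  rewrite rmorphB face_codegen_id ?eqxx //; congr (_ - _).
  rewrite /face H_nat -/(face X _) face_codegen_id ?eqxx //.
  congr (H _ z); apply: omorphism_eq => j; apply: val_inj.
  by rewrite /= !inordK ?ltnS ?leq_b1 //= /bump; lia.
rewrite -/u -wE; apply: face_boundary => j; rewrite -val_eqE /= => ji.
rewrite rmorphB; have [ji1|ji1] := eqVneq (j : nat) i.+1; last first.
  rewrite (face_codegen_cycle uc) // subr0 /face H_nat -/(face X _).
  by rewrite (face_codegen_cycle zc) // rmorph0.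
rewrite face_codegen_id ?ji1 ?eqxx ?orbT //.
rewrite /face H_nat -/(face X _) face_codegen_id ?ji1 ?eqxx ?orbT //.
apply/eqP; rewrite subr_eq0; apply/eqP.
congr (H _ z); apply: omorphism_eq => l; apply: val_inj.
by rewrite /= !inordK ?ltnS ?leq_b1 //= /bump; lia.
Qed.

Lemma homotopy_boundary n (z : X n.+1) :
  is_cycle z ->
  is_boundary (H (cst_om n.+1 ord_max) z - H (cst_om n.+1 ord0) z).
Proof.
move=> zc.
have step i : (i <= n.+2)%N ->
    is_boundary (H (threshold n.+1 0) z - H (threshold n.+1 i) z).
  elim: i => [|i IHi] lei.
    by exists 0; split=> [j _|]; rewrite rmorph0 ?subrr.
  have := homotopy_step (Ordinal lei) zc; move: (IHi (ltnW lei)) => /=.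
  by move=> /is_boundaryD H1 /H1; rewrite addrA subrK.
(* The steps telescope; on [n+1], threshold 0 is constantly 1 and threshold n + 2 is constantly
   0. *)
have {step} := step n.+2 (leqnn _).
congr is_boundary; congr (H _ z - H _ z); apply: omorphism_eq => j.
  by apply: val_inj; rewrite /= inordK.
by apply: val_inj; rewrite /= inordK ?ltnS ?leq_b1 //= ltnNge -ltnS ltn_ord.
Qed.

End Homotopy.

(** * The forest algebra and its resolution *)

Section ConstantAlgebra.
Variables (p : nat) (A : comPzRingType) (charA : p%:R = 0 :> A).

Definition const_alg : sAlg p :=
  @SAlg p (fun=> A) (fun _ _ _ => idfun)
    (fun _ _ _ _ => erefl) (fun _ _ _ _ _ _ _ _ => erefl) (fun=> charA).

End ConstantAlgebra.

(** Membership in the subring generated by [P]. *)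
Inductive spanned (B : comPzRingType) (P : B -> Prop) : B -> Prop :=
| spanned_gen b of P b : spanned P b
| spanned0 : spanned P 0
| spanned1 : spanned P 1
| spannedD a b of spanned P a & spanned P b : spanned P (a + b)
| spannedN a of spanned P a : spanned P (- a)
| spannedM a b of spanned P a & spanned P b : spanned P (a * b).

Lemma spannedX (B : comPzRingType) (P : B -> Prop) a n :
  spanned P a -> spanned P (a ^+ n).
Proof.
move=> Pa; elim: n => [|n IHn]; first exact: spanned1.
by rewrite exprS; apply: spannedM.
Qed.

Lemma spanned_sum (B : comPzRingType) (P : B -> Prop) (I : Type) (r : seq I)
    (F : I -> B) :
  (forall i, spanned P (F i)) -> spanned P (\sum_(i <- r) F i).
Proof. by move=> PF; elim/big_rec: _ => *; [exact: spanned0 | exact: spannedD]. Qed.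

Lemma spanned_map (B C : comPzRingType) (f : {rmorphism B -> C})
    (P : B -> Prop) (P' : C -> Prop) :
  (forall b, P b -> spanned P' (f b)) -> forall b, spanned P b -> spanned P' (f b).
Proof.
move=> fP b; elim=> {b} [b /fP //|||a b _ ? _ ?|a _ ?|a b _ ? _ ?].
- by rewrite rmorph0; exact: spanned0.
- by rewrite rmorph1; exact: spanned1.
- by rewrite rmorphD; exact: spannedD.
- by rewrite rmorphN; exact: spannedN.
- by rewrite rmorphM; exact: spannedM.
Qed.

Lemma spanned_sub (B : comPzRingType) (P P' : B -> Prop) :
  (forall b, P b -> P' b) -> forall b, spanned P b -> spanned P' b.
Proof.
by move=> PP' b; apply: (@spanned_map _ _ idfun) => a /PP'; exact: spanned_gen.
Qed.

(** * The forest resolution and its acyclicity in positive degrees *)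

Section Forest.
Variables (p k : nat).

(* The vertices of the k-ary trees with set of roots J: a root and the path
   leading to the vertex. *)
Definition node (J : Type) : Type := (J * seq 'I_k)%type.
(** Paths grow at the far end, so taking children commutes with deleting the first letter, which is
    what removing the roots does. *)
Definition child J (l : node J) (i : 'I_k) : node J := (l.1, rcons l.2 i).

Definition tree_alg (J : Type) : comPzRingType :=
  frob_alg p (@id (node J)) (@child J).

(** The m-simplices of a disjoint union of intervals, one per node; the constants 0 and 1 give the
    source and the target of a path. *)
Definition edge (J : Type) m : Type := (node J * {omorphism 'I_m.+1 -> 'I_2})%type.

(* m-simplices of the algebra obtained from the x_i and vertices s_l by freely
   adjoining a path from s_l to \sum_i s_(l i)^p x_i. *)
Definition forest_ob (J : Type) m : comPzRingType :=
  frob_alg p (fun l => (l, cst_om m ord_max) : edge J m)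
             (fun l i => (child l i, cst_om m ord0)).

Definition hx J m i : forest_ob J m := fx p _ _ i.
Definition hy J m (l : node J) s : forest_ob J m := fy p _ _ (l, s).

Lemma hy_rel J m (l : node J) :
  hy l (cst_om m ord_max)
    = \sum_(i < k) hy (child l i) (cst_om m ord0) ^+ p * hx J m i.
Proof. exact: (frob_alg_rel p (fun l => (l, _)) _ l). Qed.

Lemma forest_ext J m (B : comPzRingType) (f g : {rmorphism forest_ob J m -> B}) :
  (forall i, f (hx J m i) = g (hx J m i)) ->
  (forall l s, f (hy l s) = g (hy l s)) -> f =1 g.
Proof. by move=> fgx fgy; apply: frob_alg_ext => // -[]. Qed.

Lemma forest_sact_subproof J m n (f : {omorphism 'I_m.+1 -> 'I_n.+1}) :
  frob_solution p (fun l => (l, cst_om n ord_max) : edge J n)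
    (fun l i => (child l i, cst_om n ord0))
    (hx J m) (fun a => hy a.1 (a.2 \o f)).
Proof.
split=> [|l /=]; first exact: frob_alg_char.
rewrite (@omorphism_eq _ _ (_ \o f) (cst_om m ord_max)) // hy_rel.
apply: eq_bigr => i _.
by rewrite (@omorphism_eq _ _ (_ \o f) (cst_om m ord0)).
Qed.

Definition forest_sact J m n f : {rmorphism forest_ob J n -> forest_ob J m} :=
  flift (@forest_sact_subproof J m n f).

Lemma forest_sact_x J m n f i : @forest_sact J m n f (hx J n i) = hx J m i.
Proof. exact: flift_x. Qed.

Lemma forest_sact_y J m n f (l : node J) s :
  @forest_sact J m n f (hy l s) = hy l (s \o f).
Proof. exact: flift_y. Qed.

Lemma forest_sact_id J n (f : {omorphism 'I_n.+1 -> 'I_n.+1}) :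
  f =1 id -> @forest_sact J n n f =1 id.
Proof.
move=> fid; apply: (@forest_ext _ _ _ _ idfun) => [i|l s].
  exact: forest_sact_x.
rewrite forest_sact_y; congr hy; apply: omorphism_eq => j.
by rewrite /= fid.
Qed.

Lemma forest_sact_comp J l m n (f : {omorphism 'I_l.+1 -> 'I_m.+1})
    (g : {omorphism 'I_m.+1 -> 'I_n.+1}) (h : {omorphism 'I_l.+1 -> 'I_n.+1}) :
  h =1 g \o f ->
  @forest_sact J l n h =1 @forest_sact J l m f \o @forest_sact J m n g.
Proof.
move=> hgf.
apply: (@forest_ext _ _ _ _ (@forest_sact J l m f \o @forest_sact J m n g)).
  by move=> i; rewrite /= !forest_sact_x.
move=> w s; rewrite /= !forest_sact_y; congr hy; apply: omorphism_eq => j.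
by rewrite /= hgf.
Qed.

Definition forest J : sAlg p :=
  SAlg (@forest_sact_id J) (@forest_sact_comp J)
       (fun m => frob_alg_char p _ _).

(* Homotopy contracting the paths at the roots onto their endpoints. *)
Lemma contract_subproof J m (a : {omorphism 'I_m.+1 -> 'I_2}) :
  frob_solution p (fun l => (l, cst_om m ord_max) : edge J m)
    (fun l i => (child l i, cst_om m ord0))
    (hx J m) (fun b => hy b.1 (if nilp b.1.2 then max_om b.2 a else b.2)).
Proof.
split=> [|[j w] /=]; first exact: frob_alg_char.
(* Both sides of the relation are fixed: a target absorbs the maximum, and a child is never a
   root. *)
have -> : (if nilp w then max_om (cst_om m ord_max) a else cst_om m ord_max)
            = cst_om m ord_max.
  by case: nilp => //; exact: max_om_maxl.
rewrite hy_rel; apply: eq_bigr => i _.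
by rewrite /nilp size_rcons.
Qed.

Definition contract J m a : {rmorphism forest_ob J m -> forest_ob J m} :=
  flift (@contract_subproof J m a).

Lemma contract_x J m a i : @contract J m a (hx J m i) = hx J m i.
Proof. exact: flift_x. Qed.

Lemma contract_y J m a (l : node J) s :
  @contract J m a (hy l s) = hy l (if nilp l.2 then max_om s a else s).
Proof. exact: flift_y. Qed.

Lemma contract_nat J m n (f : {omorphism 'I_m.+1 -> 'I_n.+1})
    (a : {omorphism 'I_n.+1 -> 'I_2}) (x : forest J n) :
  sact (forest J) f (contract J a x) = contract J (a \o f) (sact (forest J) f x).
Proof.
move: x; apply: (@forest_ext _ _ _ (forest_sact J f \o contract J a)
                                   (contract J (a \o f) \o forest_sact J f)).
  by move=> i; rewrite /= !(contract_x, forest_sact_x).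
move=> l s; rewrite /= !(contract_y, forest_sact_y); case: nilp => //.
by congr hy; apply: omorphism_eq.
Qed.

Lemma contract0 J m : @contract J m (cst_om m ord0) =1 id.
Proof.
apply: (@forest_ext _ _ _ _ idfun) => [i|l s]; first exact: contract_x.
by rewrite contract_y; case: nilp => //=; rewrite max_om_min.
Qed.

(** Removing the roots turns their children [(j, i)] into roots. A root path collapses to its
    target, already expressed through these children. *)
Definition prune_gen J m (b : edge J m) : forest_ob (J * 'I_k) m :=
  match b with
  | ((j, [::]), _) =>
      \sum_(i < k) hy ((j, i), [::]) (cst_om m ord0) ^+ p * hx (J * 'I_k) m i
  | ((j, i :: w), s) => hy ((j, i), w) s
  end.

Lemma prune_subproof J m :
  frob_solution p (fun l => (l, cst_om m ord_max) : edge J m)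
    (fun l i => (child l i, cst_om m ord0)) (hx (J * 'I_k) m) (@prune_gen J m).
Proof.
split=> [|[j [|i w]] //=]; first exact: frob_alg_char.
exact: hy_rel.
Qed.

Definition prune J m : {rmorphism forest_ob J m -> forest_ob (J * 'I_k) m} :=
  flift (@prune_subproof J m).

Lemma prune_x J m i : prune J m (hx J m i) = hx (J * 'I_k) m i.
Proof. exact: flift_x. Qed.

Lemma prune_y J m (l : node J) s : prune J m (hy l s) = prune_gen (l, s).
Proof. exact: flift_y. Qed.

Lemma prune_nat J m n (f : {omorphism 'I_m.+1 -> 'I_n.+1}) (x : forest J n) :
  prune J m (sact (forest J) f x) = sact (forest (J * 'I_k)) f (prune J n x).
Proof.
move: x; apply: (@forest_ext _ _ _ (prune J m \o forest_sact J f)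
                   (forest_sact (J * 'I_k) f \o prune J n)).
  by move=> i; rewrite /= !(prune_x, forest_sact_x).
move=> [j [|i w]] s; rewrite /= forest_sact_y !prune_y /= ?forest_sact_y //.
rewrite rmorph_sum; apply: eq_bigr => i _.
rewrite rmorphM rmorphXn /= forest_sact_x forest_sact_y.
by congr (hy _ _ ^+ p * _); apply: omorphism_eq.
Qed.

(** The opposite map includes the forest without its roots as the subtrees hanging below them. *)
Lemma graft_subproof J m :
  frob_solution p (fun l => (l, cst_om m ord_max) : edge (J * 'I_k) m)
    (fun l i => (child l i, cst_om m ord0)) (hx J m)
    (fun b => hy (b.1.1.1, b.1.1.2 :: b.1.2) b.2).
Proof.
split=> [|[[j i] w] /=]; first exact: frob_alg_char.
exact: hy_rel.
Qed.

Definition graft_ob J m : {rmorphism forest_ob (J * 'I_k) m -> forest_ob J m} :=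
  flift (@graft_subproof J m).

Lemma graft_x J m i : graft_ob J m (hx (J * 'I_k) m i) = hx J m i.
Proof. exact: flift_x. Qed.

Lemma graft_y J m j i w s :
  graft_ob J m (hy ((j, i), w) s) = hy (j, i :: w) s.
Proof. exact: flift_y. Qed.

Lemma graft_nat J m n (f : {omorphism 'I_m.+1 -> 'I_n.+1})
    (x : forest (J * 'I_k) n) :
  graft_ob J m (sact (forest (J * 'I_k)) f x)
    = sact (forest J) f (graft_ob J n x).
Proof.
move: x; apply: (@forest_ext _ _ _ (graft_ob J m \o forest_sact (J * 'I_k) f)
                   (forest_sact J f \o graft_ob J n)).
  by move=> i; rewrite /= !(graft_x, forest_sact_x).
by move=> [[j i] w] s; rewrite /= !(forest_sact_y, graft_y).
Qed.

Definition graft J : sHom (forest (J * 'I_k)) (forest J) :=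
  @SHom p (forest (J * 'I_k)) (forest J) (graft_ob J) (@graft_nat J).

(** At the end of the homotopy every root path sits at its target, which the relation rewrites
    through the children. *)
Lemma contract1 J m : @contract J m (cst_om m ord_max) =1 graft J m \o prune J m.
Proof.
apply: forest_ext => [i|[j w] s] /=.
  by rewrite contract_x prune_x graft_x.
rewrite contract_y prune_y /=; case: w => [|i w] /=; last by rewrite graft_y.
rewrite max_om_maxr hy_rel rmorph_sum; apply: eq_bigr => i _.
by rewrite rmorphM rmorphXn /= graft_x graft_y.
Qed.

(** Arbitrary simplices occur at depth below [n], but only path sources at depth [n]: the target of
    a path at depth n - 1 involves exactly such sources. *)
Definition depth_gen J m n (b : forest_ob J m) : Prop :=
  [\/ exists i, b = hx J m i,
      exists l s, b = hy l s /\ (size l.2 < n)%N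
    | exists l, b = hy l (cst_om m ord0) /\ (size l.2 <= n)%N].

Lemma depth_gen_le J m n n' (b : forest_ob J m) :
  (n <= n')%N -> depth_gen n b -> depth_gen n' b.
Proof.
move=> nn' [H|[l [s [-> ln]]]|[l [-> ln]]]; first by constructor 1.
  by constructor 2; exists l, s; split=> //; exact: leq_trans nn'.
by constructor 3; exists l; split=> //; exact: leq_trans nn'.
Qed.

Lemma depth_exists J m (b : forest_ob J m) :
  exists n, spanned (@depth_gen J m n) b.
Proof.
move: b; apply: frob_alg_ind => [i|[l s]|||a b|a|a b].
- by exists 0%N; apply: spanned_gen; constructor 1; exists i.
- exists (size l.2).+1; apply: spanned_gen; constructor 2.
  by exists l, s; split.
- by exists 0%N; exact: spanned0.
- by exists 0%N; exact: spanned1.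
- move=> [na da] [nb db]; exists (maxn na nb); apply: spannedD.
    by apply: spanned_sub da => c; apply: depth_gen_le; exact: leq_maxl.
  by apply: spanned_sub db => c; apply: depth_gen_le; exact: leq_maxr.
- by move=> [na da]; exists na; exact: spannedN.
- move=> [na da] [nb db]; exists (maxn na nb); apply: spannedM.
    by apply: spanned_sub da => c; apply: depth_gen_le; exact: leq_maxl.
  by apply: spanned_sub db => c; apply: depth_gen_le; exact: leq_maxr.
Qed.

Lemma prune_depth J m n (b : forest_ob J m) :
  spanned (@depth_gen J m n.+1) b ->
  spanned (@depth_gen (J * 'I_k) m n) (prune J m b).
Proof.
have root j s : spanned (@depth_gen (J * 'I_k) m n) (prune J m (hy (j, [::]) s)).
  rewrite prune_y /= ; apply: spanned_sum => i; apply: spannedM.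
    by apply/spannedX/spanned_gen; constructor 3; exists ((j, i), [::]).
  by apply: spanned_gen; constructor 1; exists i.
apply: spanned_map => _ [[i ->]|[[j [|i w]] [s [-> wn]]]|[[j [|i w]] [-> wn]]] //.
- by rewrite prune_x; apply: spanned_gen; constructor 1; exists i.
- rewrite prune_y; apply: spanned_gen; constructor 2.
  by exists ((j, i), w), s.
- rewrite prune_y; apply: spanned_gen; constructor 3.
  by exists ((j, i), w).
Qed.

(** Only the x_i and sources remain, and all of these are pulled back from degree 0. *)
Lemma depth0_degenerate J m (b : forest J m) :
  spanned (@depth_gen J m 0) b ->
  exists a : forest J 0, b = sact (forest J) (to_point m) a.
Proof.
elim=> {b} [_ [[i ->]|[l [s [_]]] //|[l [-> _]]]|||a b _ [a' ->] _ [b' ->]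
           |a _ [a' ->]|a b _ [a' ->] _ [b' ->]].
- by exists (hx J 0 i); rewrite /= forest_sact_x.
- exists (hy l (cst_om 0 ord0)); rewrite /= forest_sact_y; congr hy.
  exact: omorphism_eq.
- by exists 0; rewrite rmorph0.
- by exists 1; rewrite rmorph1.
- by exists (a' + b'); rewrite rmorphD.
- by exists (- a'); rewrite rmorphN.
- by exists (a' * b'); rewrite rmorphM.
Qed.

(** Induction on depth, for all [J] at once since pruning changes the roots: the contraction makes
    [z] homologous to its pruned and regrafted image, whose pruned part is shallower. *)
Lemma forest_acyclic J m (z : forest J m.+1) : is_cycle z -> is_boundary z.
Proof.
have [n] := depth_exists z; elim: n J z => [|n IHn] J z dz zc.
  have [a za] := depth0_degenerate dz.
  (* A vertex of a face of the degenerate simplex [z] is [a] itself, while the faces of [z]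
     vanish. *)
  have a0 : a = 0.
    have := zc ord0.
    rewrite za /face sactA => /(congr1 (sact (forest J) (cst_om 0 ord0))).
    by rewrite rmorph0 sactA sact_id // => j; rewrite (ord1 j).
  by rewrite za a0; exists 0; split=> [i _|]; rewrite !rmorph0.
have pc : is_cycle (prune J m.+1 z : forest (J * 'I_k) m.+1).
  by move=> i; rewrite /face -prune_nat -/(face _ i) zc rmorph0.
have := homotopy_boundary (@contract_nat J) zc.
rewrite contract1 contract0 => /is_boundaryN; rewrite opprB => zb.
rewrite -[z](subrK ((graft J m.+1 \o prune J m.+1) z)).
apply: is_boundaryD => //; apply: (@shom_boundary _ _ _ (graft J)).
exact: IHn (prune_depth dz) pc.
Qed.

End Forest.

(** * The morphism from vertices to H^0, and constant algebras *)

Section H0Class.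
Variables (p : nat) (X : sAlg p).

Lemma H0_class_nmod_morphism : nmod_morphism (@H0_class p X).
Proof.
split; last exact: H0_classD.
by apply: (addIr (H0_class (0 : X 0))); rewrite -H0_classD !add0r.
Qed.

Lemma H0_class_monoid_morphism : monoid_morphism (@H0_class p X).
Proof. by split; [|exact: H0_classM]. Qed.

HB.instance Definition _ :=
  GRing.isNmodMorphism.Build (X 0) (H0 X) (@H0_class p X) H0_class_nmod_morphism.
HB.instance Definition _ :=
  GRing.isMonoidMorphism.Build (X 0) (H0 X) (@H0_class p X)
    H0_class_monoid_morphism.

End H0Class.

Lemma H0_map_class p (X Y : sAlg p) (f : sHom X Y) (x : X 0) :
  H0_map f (H0_class x) = H0_class (f 0 x).
Proof.
rewrite /H0_map /H0_class hgroup_mapE; congr (\pi_(hgroup Y 0) _).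
exact: val_inj.
Qed.

Lemma hgroup_trivial p (X : sAlg p) n :
  (forall z : X n, is_cycle z -> is_boundary z) -> forall a b : hgroup X n, a = b.
Proof.
move=> acyc a b; rewrite -[a]reprK -[b]reprK; apply/eqP/hgroupP.
apply: (acyc (mcycle_val (repr a - repr b))).
by have /asboolP := valP (repr a - repr b).
Qed.

Lemma const_alg_cycle p (A : comPzRingType) (charA : p%:R = 0 :> A) n
    (z : const_alg charA n.+1) : is_cycle z -> is_boundary z.
Proof.
by move=> /(_ ord0) /= ->; exists 0; split=> [i _|]; rewrite rmorph0.
Qed.

(** All faces are the identity, so the vanishing of face 1 forces [w] to be zero. *)
Lemma const_alg_boundary p (A : comPzRingType) (charA : p%:R = 0 :> A)
    (z : const_alg charA 0) : is_boundary z -> z = 0.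
Proof. by case=> w [/(_ ord_max isT)] /= -> <-. Qed.

Lemma weak_equivalence_id p (X : sAlg p) (f : sHom X X) :
  (forall n, f n =1 id) -> weak_equivalence f.
Proof.
move=> fid n; exists id => a; rewrite /hgroup_map -[RHS]reprK;
  by congr (\pi_(hgroup X n) _); apply: val_inj => /=; rewrite fid.
Qed.

Definition sHom_id p (X : sAlg p) : sHom X X :=
  @SHom p X X (fun=> idfun) (fun _ _ _ _ => erefl).

(** * The algebra T and its resolution by the forest *)

Section Tree.
Variables (p k : nat) (J : Type).

Definition tx i : tree_alg p k J := fx p _ _ i.
Definition ty l : tree_alg p k J := fy p _ _ l.

Lemma ty_rel l : ty l = \sum_(i < k) ty (child l i) ^+ p * tx i.
Proof. exact: (frob_alg_rel p id _ l). Qed.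

Lemma tree_ext (B : comPzRingType) (f g : {rmorphism tree_alg p k J -> B}) :
  (forall i, f (tx i) = g (tx i)) -> (forall l, f (ty l) = g (ty l)) -> f =1 g.
Proof. exact: frob_alg_ext. Qed.

Definition tree : sAlg p := const_alg (frob_alg_char p _ _ : p%:R = 0 :> tree_alg p k J).

Lemma forest_aug_subproof m :
  frob_solution p (fun l => (l, cst_om m ord_max) : edge k J m)
    (fun l i => (child l i, cst_om m ord0)) tx (fun b => ty b.1).
Proof. by split; [exact: frob_alg_char | exact: ty_rel]. Qed.

Definition forest_aug_ob m : {rmorphism forest_ob p k J m -> tree_alg p k J} :=
  flift (forest_aug_subproof m).

Lemma forest_aug_x m i : forest_aug_ob m (hx p J m i) = tx i.
Proof. exact: flift_x. Qed.

Lemma forest_aug_y m (l : node k J) s : forest_aug_ob m (hy p l s) = ty l.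
Proof. exact: flift_y. Qed.

Lemma forest_aug_nat m n (f : {omorphism 'I_m.+1 -> 'I_n.+1})
    (x : forest p k J n) :
  forest_aug_ob m (sact (forest p k J) f x) = sact tree f (forest_aug_ob n x).
Proof.
move: x; apply: (@forest_ext _ _ _ _ _ (forest_aug_ob m \o forest_sact p k J f)
                                       (forest_aug_ob n)).
  by move=> i; rewrite /= forest_sact_x !forest_aug_x.
by move=> l s; rewrite /= forest_sact_y !forest_aug_y.
Qed.

Definition forest_aug : sHom (forest p k J) tree :=
  @SHom p (forest p k J) tree forest_aug_ob forest_aug_nat.

Lemma H0_forest_rel (l : node k J) :
  H0_class (hy p l (cst_om 0 ord0) : forest p k J 0)
    = H0_class (hy p l (cst_om 0 ord_max) : forest p k J 0).
Proof.
apply/eqP/H0_classP.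
pose s : {omorphism 'I_2 -> 'I_2} := idfun.
(* The degenerate source minus the path itself: face 1 leaves source minus source, face 0 leaves
   source minus target. *)
exists (hy p l (cst_om 1 ord0) - hy p l s); split=> [i i0|];
  rewrite rmorphB /= /face /= !forest_sact_y.
  apply/eqP; rewrite subr_eq0; apply/eqP; congr hy; apply: omorphism_eq => j.
  by apply: ord_inj; case: i j i0 => [[|[|]]] // i1 [[|]].
congr (hy _ _ _ - hy _ _ _); apply: omorphism_eq => j //.
by apply: ord_inj; case: j => [[|]].
Qed.

Lemma tree_to_H0_subproof :
  frob_solution p id (@child k J)
    (fun i => H0_class (hx p J 0 i : forest p k J 0))
    (fun l => H0_class (hy p l (cst_om 0 ord0) : forest p k J 0)).
Proof.
split=> [|l]; first exact: H0_char.
rewrite H0_forest_rel hy_rel rmorph_sum; apply: eq_bigr => i _.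
by rewrite rmorphM rmorphXn.
Qed.

Definition tree_to_H0 : {rmorphism tree_alg p k J -> H0 (forest p k J)} :=
  flift tree_to_H0_subproof.

(** A 0-simplex of the interval is one of its two ends, and these have the same class. *)
Lemma tree_to_H0K (q : forest p k J 0) :
  tree_to_H0 (forest_aug_ob 0 q) = H0_class q.
Proof.
pose cls : {rmorphism forest p k J 0 -> H0 (forest p k J)} := @H0_class p _.
move: q; apply: (@forest_ext _ _ _ _ _ (tree_to_H0 \o forest_aug_ob 0) cls).
  by move=> i; rewrite /= forest_aug_x [LHS]flift_x.
move=> l s; rewrite /= forest_aug_y [LHS]flift_y.
have [s0|s1] := eqVneq (s ord0) ord0.
  by have -> : s = cst_om 0 ord0 by apply: omorphism_eq => j; rewrite (ord1 j).
rewrite H0_forest_rel; have -> // : s = cst_om 0 ord_max.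
apply: omorphism_eq => j; rewrite (ord1 j); apply: ord_inj.
by case: (s ord0) s1 => [[|[|]]].
Qed.

Lemma forest_aug_surj (t : tree_alg p k J) :
  exists q : forest p k J 0, forest_aug_ob 0 q = t.
Proof.
move: t; apply: frob_alg_ind => [i|l|||a b [a' <-] [b' <-]|a [a' <-]
                                |a b [a' <-] [b' <-]].
- by exists (hx p J 0 i); exact: forest_aug_x.
- by exists (hy p l (cst_om 0 ord0)); exact: forest_aug_y.
- by exists 0; exact: rmorph0.
- by exists 1; exact: rmorph1.
- by exists (a' + b'); exact: rmorphD.
- by exists (- a'); exact: rmorphN.
- by exists (a' * b'); exact: rmorphM.
Qed.

Lemma forest_aug_weq : weak_equivalence forest_aug.
Proof.
case=> [|n]; last first.
  have acyc := hgroup_trivial (@forest_acyclic p k J n).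
  have acyc' := hgroup_trivial (@const_alg_cycle p _ (frob_alg_char p _ _) n).
  (* In positive degrees both groups have a single element. *)
  by exists (fun=> 0) => a; [exact: acyc | exact: acyc'].
pose g (a : H0 tree) : H0 (forest p k J) := tree_to_H0 (H0_repr a).
have gK q : g (H0_map forest_aug (H0_class q)) = H0_class q.
  rewrite H0_map_class -[RHS]tree_to_H0K /g; congr (tree_to_H0 _).
  (* Nothing is identified in H^0 of a constant algebra, so the representative of a class is the
     original element. *)
  have /eqP/H0_classP/const_alg_boundary :=
    H0_reprK (H0_class (forest_aug 0 q)).
  by move=> /eqP; rewrite subr_eq0 => /eqP.
exists g => [a|a].
  by rewrite -[a]H0_reprK; exact: gK.
rewrite -[a](@H0_reprK p tree); have [q <-] := forest_aug_surj (H0_repr a).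
by rewrite -[H0_class _](H0_map_class forest_aug) gK.
Qed.

End Tree.

(** * Relative perfectness *)

Section PrimeField.
Variables (p : nat) (p_pr : prime p) (A : comPzRingType) (charA : p%:R = 0 :> A).

(** Natural representatives give a map that makes sense for the zero ring as well. *)
Definition Fp_map of p%:R = 0 :> A := fun c : 'F_p => (c : nat)%:R : A.

Lemma natr_modp n : (n %% p)%:R = n%:R :> A.
Proof. by rewrite [in RHS](divn_eq n p) natrD natrM charA mulr0 add0r. Qed.

Lemma Fp_map_nmod_morphism : nmod_morphism (Fp_map charA).
Proof.
split=> // a b; rewrite /Fp_map -natrD.
by rewrite -[RHS]natr_modp /=; congr (_ %% _)%:R; exact: Fp_cast.
Qed.

Lemma Fp_map_monoid_morphism : monoid_morphism (Fp_map charA).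
Proof.
split=> [|a b]; rewrite /Fp_map -?natrM.
  by rewrite /= modn_small.
by rewrite -[RHS]natr_modp /=; congr (_ %% _)%:R; exact: Fp_cast.
Qed.

HB.instance Definition _ :=
  GRing.isNmodMorphism.Build 'F_p A (Fp_map charA) Fp_map_nmod_morphism.
HB.instance Definition _ :=
  GRing.isMonoidMorphism.Build 'F_p A (Fp_map charA) Fp_map_monoid_morphism.

Definition Fp_hom : {rmorphism 'F_p -> A} := Fp_map charA.

End PrimeField.

Lemma sum_fsfun (B : nmodType) (R : nmodType) (I : finType)
    (c : {fsfun I -> B with 0}) (G : I -> R) :
  (forall i, c i = 0 -> G i = 0) ->
  \sum_(i <- finsupp c) G i = \sum_i G i.
Proof.
move=> G0; rewrite [RHS](bigID (mem (finsupp c))) /=.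
rewrite [X in _ + X]big1 => [|i]; last by rewrite memNfinsupp => /eqP/G0.
rewrite addr0 -[RHS]big_filter; apply: perm_big; apply: uniq_perm.
- exact: fset_uniq.
- exact/filter_uniq/index_enum_uniq.
- by move=> i; rewrite mem_filter mem_index_enum andbT.
Qed.

(** * Freeness of the Frobenius of a polynomial ring *)

Section PolynomialFrobenius.
Variables (p : nat) (p_pr : prime p) (k : nat).

Lemma mpoly_hom_ext (B : comPzRingType) (f g : {rmorphism {mpoly 'F_p[k]} -> B}) :
  (forall i, f 'X_i = g 'X_i) -> f =1 g.
Proof.
move=> fg q; rewrite [q]mpolyE !rmorph_sum; apply: eq_bigr => m _.
rewrite -mul_mpolyC !rmorphM; congr (_ * _).
  (* Coefficients in F_p are numerals, on which all ring morphisms agree. *)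
  by rewrite -[q@_m]natr_Zp mpolyC_nat !rmorph_nat.
rewrite mpolyXE_id !rmorph_prod; apply: eq_bigr => i _.
by rewrite !rmorphXn fg.
Qed.

Let p_gt0 : (0 < p)%N := prime_gt0 p_pr.

(** Dividing exponents by p with remainder writes each monomial uniquely as a p-th power times a
    monomial with exponents below p; the latter form the basis. *)
Definition residue (m : 'X_{1..k}) : {ffun 'I_k -> 'I_p} :=
  [ffun i => Ordinal (ltn_pmod (m i) p_gt0)].
Definition quotient_mnm (m : 'X_{1..k}) : 'X_{1..k} := [multinom m i %/ p | i < k]%N.
Definition residue_mnm (a : {ffun 'I_k -> 'I_p}) : 'X_{1..k} :=
  [multinom (a i : nat) | i < k].

Lemma mnm_divn_eq m : m = (quotient_mnm m *+ p + residue_mnm (residue m))%MM.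
Proof.
by apply/mnmP=> i; rewrite mnmDE mulmnE !mnmE ffunE /= -divn_eq.
Qed.

Lemma residueE m a : residue (m *+ p + residue_mnm a)%MM = a.
Proof.
apply/ffunP=> i; rewrite ffunE; apply: val_inj => /=.
by rewrite mnmDE mulmnE mnmE modnMDl modn_small.
Qed.

Lemma quotient_mnmE m a : quotient_mnm (m *+ p + residue_mnm a)%MM = m.
Proof.
apply/mnmP=> i; rewrite mnmE mnmDE mulmnE mnmE.
by rewrite divnMDl // divn_small ?addn0.
Qed.

Lemma Fp_exp_p (c : 'F_p) : c ^+ p = c.
Proof.
rewrite -[c]natr_Zp; exact: (rmorph_nat (frobenius p_pr (pchar_Fp_0 p_pr))).
Qed.

Lemma mpoly_exp_p (I : Type) (r : seq I) (P : pred I) (c : I -> 'F_p) (m : I -> 'X_{1..k}) :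
  (\sum_(i <- r | P i) c i *: 'X_[m i]) ^+ p
    = \sum_(i <- r | P i) c i *: 'X_[(m i *+ p)%MM] :> {mpoly 'F_p[k]}.
Proof.
rewrite [LHS](raddf_sum (frobenius p_pr (mpoly_char p_pr k))) /= /frob.
by apply: eq_bigr => i _; rewrite exprZn Fp_exp_p mpolyXn.
Qed.

(** The exponents of c^p are p times those of c, with the same coefficients by Fermat, so division
    with remainder recovers [a] and [m]. *)
Lemma mcoeff_frobenius_basis (c : {mpoly 'F_p[k]}) a b m :
  (c ^+ p * 'X_[residue_mnm a])@_(m *+ p + residue_mnm b)%MM
    = if a == b then c@_m else 0.
Proof.
rewrite [c in LHS]mpolyE mpoly_exp_p mulr_suml raddf_sum /=.
have -> : (if a == b then c@_m else 0)
    = \sum_(m' <- msupp c) c@_m' * ((m' == m) && (a == b))%:R.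
  have [_|_] := eqVneq a b; last first.
    by rewrite big1 // => m' _; rewrite andbF mulr0.
  rewrite {1}[c]mpolyE raddf_sum; apply: eq_bigr => m' _.
  by rewrite /= mcoeffZ mcoeffX andbT.
apply: eq_bigr => m' _; rewrite -scalerAl -mpolyXD mcoeffZ mcoeffX.
congr (_ * _%:R); congr nat_of_bool.
apply/eqP/andP => [E|[/eqP -> /eqP ->] //].
have := congr1 residue E; have := congr1 quotient_mnm E.
by rewrite !quotient_mnmE !residueE => -> ->.
Qed.

Lemma mpoly_frobenius_free :
  free_ring_map (frobenius p_pr (mpoly_char p_pr k)).
Proof.
exists {ffun 'I_k -> 'I_p}, (fun a => 'X_[residue_mnm a]) => b /=.
rewrite /frob.
have sumE (c : {fsfun {ffun 'I_k -> 'I_p} -> {mpoly 'F_p[k]} with 0}) :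
    \sum_(a <- finsupp c) c a ^+ p * 'X_[residue_mnm a]
      = \sum_a c a ^+ p * 'X_[residue_mnm a].
  by apply: sum_fsfun => a ->; rewrite expr0n gtn_eqF ?mul0r.
(* The coordinate at [a] collects the monomials of [b] with residue [a]. *)
pose q a := \sum_(m <- msupp b | residue m == a) b@_m *: 'X_[quotient_mnm m].
pose c := [fsfun a in [fset a | a in {ffun 'I_k -> 'I_p}]%fset => q a | 0]
  : {fsfun {ffun 'I_k -> 'I_p} -> {mpoly 'F_p[k]} with 0}.
have cE a : c a = q a by rewrite fsfunE !inE.
(* Uniqueness: the coefficients of any coordinates are read off from [b]. *)
have coefE (d : {fsfun {ffun 'I_k -> 'I_p} -> {mpoly 'F_p[k]} with 0}) a m :
    b = \sum_(a <- finsupp d) d a ^+ p * 'X_[residue_mnm a] ->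
    (d a)@_m = b@_(m *+ p + residue_mnm a)%MM.
  rewrite sumE => ->; rewrite raddf_sum /= (bigD1 a) //=.
  rewrite mcoeff_frobenius_basis eqxx big1 ?addr0 // => a' /negPf na.
  by rewrite mcoeff_frobenius_basis na.
have cP : b = \sum_(a <- finsupp c) c a ^+ p * 'X_[residue_mnm a].
  rewrite sumE [LHS]mpolyE (partition_big residue xpredT) //=.
  apply: eq_bigr => a _; rewrite cE mpoly_exp_p mulr_suml.
  apply: eq_bigr => m /eqP <-.
  by rewrite -scalerAl -mpolyXD -mnm_divn_eq.
exists c; split=> // c' c'P.
by apply/fsfunP=> a; apply/mpolyP=> m; rewrite !coefE.
Qed.

End PolynomialFrobenius.

(** * T over the polynomial ring *)

Section TreePerfect.
Variables (p : nat) (p_pr : prime p) (k : nat) (J : Type).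

(** Sending all generators to 0 in F_p respects the relations. Nontriviality makes this ring a
    target for [mmap]. *)
Lemma tree_alg_neq0 : (1 : tree_alg p k J) != 0.
Proof.
have sol : frob_solution p id (@child k J) (fun=> 0 : 'F_p) (fun=> 0 : 'F_p).
  by split=> [|l]; [exact: pchar_Fp_0 | rewrite big1 // => i _; rewrite mulr0].
apply/eqP => /(congr1 (flift sol)) /eqP.
by rewrite rmorph0 rmorph1 oner_eq0.
Qed.

Definition nz_tree_alg : comNzRingType :=
  HB.pack (tree_alg p k J)
    (GRing.PzSemiRing_isNonZero.Build (tree_alg p k J) tree_alg_neq0).

Definition Fp_tree : {rmorphism 'F_p -> nz_tree_alg} :=
  Fp_hom p_pr (frob_alg_char p _ _).

Definition tree_incl_nz : {rmorphism {mpoly 'F_p[k]} -> nz_tree_alg} :=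
  
  mmap Fp_tree (@tx p k J).

Definition tree_incl_ob : {rmorphism {mpoly 'F_p[k]} -> tree_alg p k J} :=
  tree_incl_nz.

Lemma tree_incl_ob_X i : tree_incl_ob 'X_i = tx p J i.
Proof.
have -> : tx p J i = mmap1 (tx p J : 'I_k -> nz_tree_alg) U_(i)%MM by rewrite mmap1U.
exact: (mmapX (tx p J : 'I_k -> nz_tree_alg) Fp_tree).
Qed.

Definition tree_incl : sHom (free_alg p_pr k) (tree p k J) :=
  @SHom p (free_alg p_pr k) (tree p k J) (fun=> tree_incl_ob)
    (fun _ _ _ _ => erefl).

(* The square exhibiting T as its own Frobenius twist over F_p[x_1, ..., x_k]:
   a map out of the twist is inverted by s_l |-> \sum_i s_(l i) x_i. *)
Lemma tree_frobenius_pushout :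
  is_pushout tree_incl (sFrobenius p_pr (free_alg p_pr k))
    (sFrobenius p_pr (tree p k J)) tree_incl.
Proof.
split=> [n q|W a b ab]; first exact: (esym (rmorphXn tree_incl_ob p q)).
have abX n i : a n (tx p J i) = b n ('X_i : {mpoly 'F_p[k]}) ^+ p.
  rewrite -tree_incl_ob_X -rmorphXn; exact: (ab n 'X_i).
have sol n : frob_solution p id (@child k J)
    (fun i => b n ('X_i : {mpoly 'F_p[k]}))
    (fun l => \sum_(i < k) a n (ty p (child l i)) * b n ('X_i : {mpoly 'F_p[k]})).
  split=> [|l]; first exact: sob_char.
  (* It suffices that a(s_(l i)) is the p-th power of the proposed value at s_(l i). This is the
     relation one level down, since a(x_j) = b(x_j)^p. *)
  apply: eq_bigr => i _; congr (_ * _).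
  rewrite -[RHS]/(frobenius p_pr (sob_char W n) _) rmorph_sum /=.
  rewrite ty_rel rmorph_sum; apply: eq_bigr => j _.
  by rewrite rmorphM rmorphXn abX /frob exprMn.
pose h n := flift (sol n).
have h_x n i : h n (tx p J i) = b n ('X_i : {mpoly 'F_p[k]}) by exact: flift_x.
have h_y n l : h n (ty p l)
    = \sum_(i < k) a n (ty p (child l i)) * b n ('X_i : {mpoly 'F_p[k]}).
  exact: flift_y.
have h_nat m n (f : {omorphism 'I_m.+1 -> 'I_n.+1}) (x : tree p k J n) :
    h m (sact (tree p k J) f x) = sact W f (h n x).
  move: x; apply: (@tree_ext _ _ _ _ (h m) (sact W f \o h n)) => [i|l] /=.
    by rewrite !h_x -shom_nat.
  rewrite !h_y rmorph_sum; apply: eq_bigr => i _.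
  by rewrite rmorphM -!shom_nat.
exists (@SHom p (tree p k J) W h h_nat); split=> [n|n|kk kka kkb n].
- apply: (@tree_ext _ _ _ _ (h n \o frobenius p_pr (frob_alg_char p _ _)) (a n)).
    by move=> i; rewrite /= /frob rmorphXn h_x abX.
  move=> l; rewrite /= /frob rmorphXn h_y [ty p l]ty_rel.
  rewrite -[LHS]/(frobenius p_pr (sob_char W n) _) !rmorph_sum /=.
  apply: eq_bigr => i _.
  by rewrite rmorphM rmorphXn abX /frob exprMn.
- apply: (@mpoly_hom_ext _ _ _ (h n \o tree_incl_ob) (b n)) => i.
  by rewrite -h_x -tree_incl_ob_X.
  (* Uniqueness: [kk] is given by [b] on x_i and by [a] on p-th powers, and the relation writes s_l
     in these terms. *)
  have kX i : kk n (tx p J i) = b n ('X_i : {mpoly 'F_p[k]}).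
    by rewrite -tree_incl_ob_X; exact: kkb.
  apply: (@tree_ext _ _ _ _ (kk n) (h n)) => [i|l].
    by rewrite kX h_x.
  rewrite h_y ty_rel rmorph_sum; apply: eq_bigr => i _.
  by rewrite rmorphM kX -kka.
Qed.

(** The Frobenius of the polynomial ring is free, so the identity serves as resolution and the
    derived pushout is the strict one. That is T itself, with the identity as relative Frobenius. *)
Lemma tree_relatively_perfect : relatively_perfect p_pr tree_incl.
Proof.
pose R := free_alg p_pr k.
have fact n : sHom_id R n \o sFrobenius p_pr R n =1 sFrobenius p_pr R n by [].
have weqR : weak_equivalence (sHom_id R) by exact: weak_equivalence_id.
exists (DerivedPushout fact (fun n => mpoly_frobenius_free p_pr k) weqR
          tree_frobenius_pushout).
exists (sHom_id (tree p k J)); split; last exact: weak_equivalence_id.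
by split.
Qed.

End TreePerfect.

(** * The map to S *)

Section TreeMap.
Variables (p k : nat) (S : sAlg p).
Variables (x : 'I_k -> S 0) (d : S 0 -> 'I_k -> S 0) (path : S 0 -> S 1).
Hypothesis path_src : forall s, sact S (cst_om 0 ord0) (path s) = s.
Hypothesis path_tgt : forall s,
  sact S (cst_om 0 ord_max) (path s) = \sum_(i < k) d s i ^+ p * x i.

(** Starting at the root, each letter of the path passes to the corresponding chosen coefficient. *)
Definition node_val (l : node k (S 0)) : S 0 := foldl d l.1 l.2.

Lemma node_val_child l i : node_val (child l i) = d (node_val l) i.
Proof. by rewrite /node_val /= -cats1 foldl_cat. Qed.

Lemma forest_val_subproof m :
  frob_solution p (fun l => (l, cst_om m ord_max) : edge k (S 0) m)
    (fun l i => (child l i, cst_om m ord0))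
    (fun i => sact S (to_point m) (x i))
    (fun b => sact S b.2 (path (node_val b.1))).
Proof.
(* Constant maps factor through a point, so the relations in degree m follow from those in degree
   0. *)
have cstE a s : sact S (cst_om m a) (path s)
    = sact S (to_point m) (sact S (cst_om 0 a) (path s)).
  by rewrite sactA; apply: sact_ext.
split=> [|l /=]; first exact: sob_char.
rewrite cstE path_tgt rmorph_sum; apply: eq_bigr => i _.
by rewrite rmorphM rmorphXn cstE path_src node_val_child.
Qed.

Definition forest_val_ob m : {rmorphism forest_ob p k (S 0) m -> S m} :=
  flift (forest_val_subproof m).

Lemma forest_val_x m i :
  forest_val_ob m (hx p (S 0) m i) = sact S (to_point m) (x i).
Proof. exact: flift_x. Qed.

Lemma forest_val_y m (l : node k (S 0)) s :
  forest_val_ob m (hy p l s) = sact S s (path (node_val l)).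
Proof. exact: flift_y. Qed.

Lemma forest_val_nat m n (f : {omorphism 'I_m.+1 -> 'I_n.+1})
    (q : forest p k (S 0) n) :
  forest_val_ob m (sact (forest p k (S 0)) f q) = sact S f (forest_val_ob n q).
Proof.
move: q; apply: (@forest_ext _ _ _ _ _ (forest_val_ob m \o forest_sact p k (S 0) f)
                                       (sact S f \o forest_val_ob n)).
  move=> i; rewrite /= forest_sact_x !forest_val_x sactA; exact: sact_ext.
by move=> l s; rewrite /= forest_sact_y !forest_val_y sactA.
Qed.

Definition forest_val : sHom (forest p k (S 0)) S :=
  @SHom p (forest p k (S 0)) S forest_val_ob forest_val_nat.

Lemma forest_val_vertex s : forest_val 0 (hy p (s, [::]) (cst_om 0 ord0)) = s.
Proof. by rewrite [LHS]forest_val_y path_src. Qed.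

End TreeMap.

Lemma H0_path p (S : sAlg p) (s t : S 0) :
  H0_class s = H0_class t ->
  exists e : S 1,
    sact S (cst_om 0 ord0) e = s /\ sact S (cst_om 0 ord_max) e = t.
Proof.
move=> /eqP/H0_classP[w [w0 wE]].
have face1 y : sact S (cst_om 0 ord0) y = face S ord_max y.
  by apply: sact_ext => j; rewrite (ord1 j); apply: ord_inj.
have face0 y : sact S (cst_om 0 ord_max) y = face S ord0 y.
  by apply: sact_ext => j; rewrite (ord1 j); apply: ord_inj.
have deg i y : face S i (sact S (to_point 1) y) = y.
  by rewrite /face sactA sact_id // => j; rewrite (ord1 j).
(* Since [w] has face 1 zero and face 0 equal to s - t, this edge has face 1 equal to s and face 0
   equal to t. *)
exists (sact S (to_point 1) s - w); rewrite face0 face1 !rmorphB !deg w0 //.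
by rewrite wE subr0 opprB addrC subrK.
Qed.

Theorem corollaryC (p : nat) (p_pr : prime p) (S : sAlg p) :
  F_finite p_pr S ->
  exists (k : nat) (T : sAlg p) (f : sHom (free_alg p_pr k) T),
    relatively_perfect p_pr f /\ exists phi : aMap T S, H0_surjective phi.
Proof.
move=> [k [g gP]].
have step s : exists de : ('I_k -> S 0) * S 1,
    sact S (cst_om 0 ord0) de.2 = s /\
    sact S (cst_om 0 ord_max) de.2
      = \sum_(i < k) de.1 i ^+ p * H0_repr (g i).
  have [a aE] := gP (H0_class s).
  have := @H0_path _ _ s (\sum_(i < k) H0_repr (a i) ^+ p * H0_repr (g i)).
  (* Lifting the coefficients to vertices turns the equation in H^0 into a path. *)
  case=> [|e [e0 e1]]; last by exists (fun i => H0_repr (a i), e).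
  rewrite aE rmorph_sum; apply: eq_bigr => i _.
  by rewrite rmorphM rmorphXn /= !H0_reprK.
have [de deP] := choice step.
pose v := forest_val (fun s => (deP s).1) (fun s => (deP s).2).
exists k, (tree p k (S 0)), (tree_incl p_pr k (S 0)).
split; first exact: tree_relatively_perfect.
exists (AMap (@forest_aug_weq p k (S 0)) v) => y.
(* The root labelled by a representative of [y] maps to that representative. *)
exists (H0_class (hy p (H0_repr y, [::]) (cst_om 0 ord0) : forest p k (S 0) 0)).
by rewrite H0_map_class forest_val_vertex H0_reprK.
Qed.
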